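(* Let $b>1$ be an integer and let $A\subsetneq\{0,1,\dots,b-1\}$ be a proper subset of base-$b$ digits with $A\neq\{0\}$; let $N=\#A$ (so $N<b$). Call a non-negative integer admissible if every digit of its base-$b$ representation (without leading zeros) lies in $A$, and let $\sum'$ denote a sum restricted to admissible integers. Let $K=\sum'_{n>0} 1/n$. For $l\geq1$, $m\geq0$ put $\beta_{l,m}=\sum'_{b^{l-1}\leq n<b^l} n^{-m}$, and for $j\geq1$ put $\gamma_j=\sum_{a\in A}a^j$. Define $u_0=b/(b-N)$ and, for $m\geq1$, $u_m$ by $$(b^{m+1}-N)\,u_m=\sum_{j=1}^{m}\binom{m}{j}\gamma_j u_{m-j}.$$ Then for every $l\geq1$, $$K=\sum\nolimits'_{0<n<b^{l-1}}\frac1n+\frac{b}{b-N}\sum\nolimits'_{b^{l-1}\leq n<b^l}\frac1n+\sum_{m=1}^\infty(-1)^m u_m\,\beta_{l,m+1},$$ the series on the right being alternating; moreover, unless $l=1$, $1\in A$ and $b-1\in A$ all hold, its convergence is geometric (the terms $u_m\beta_{l,m+1}$ are $O(\rho^m)$ for some $\rho<1$). Furthermore, letting $f=\max A$ and defining $\lambda_{m+1}$ for $m\geq0$ by $$u_m=\frac{\lambda_{m+1}}{m+1}\Big(\frac{f}{b-1}\Big)^m\frac{b}{b-N},$$ one has $\lambda_1=1$ and $b^{-1}<\lambda_{m+1}<1$ for all $m+1\geq2$, and the ratios $\lambda_{m+1}/(m+1)$ are positive and strictly decreasing towards zero.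
   Context: Base-$b$ representations use digits $\{0,\dots,b-1\}$. The coefficients $u_m$ do not depend on $l$. *)

(* Defs.v *)
From HB Require Import structures.
From mathcomp Require Import all_boot all_order all_algebra.
From mathcomp Require Import all_classical all_reals all_analysis.

Set Implicit Arguments.
Unset Strict Implicit.
Unset Printing Implicit Defensive.

Import Order.TTheory GRing.Theory Num.Theory.
Import numFieldNormedType.Exports.

Local Open Scope ring_scope.

(* Least significant digit first. For b > 1 and n > 0, [trunc_log b n] is the
   largest e with b ^ e <= n, so the leading digit is nonzero; 0 is written
   with the single digit 0. *)
Definition digits (b n : nat) : seq nat :=
  [seq ((n %/ b ^ i) %% b)%N | i <- iota 0 (trunc_log b n).+1].

Definition admissible (b : nat) (A : {set 'I_b}) (n : nat) : bool :=
  all (fun d => d \in [seq val a | a in A]) (digits b n).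

Definition Ksum_partial (R : realType) (b : nat) (A : {set 'I_b}) (n : nat) : R :=
  \sum_(1 <= k < n.+1 | admissible A k) k%:R^-1.

Definition Ksum (R : realType) (b : nat) (A : {set 'I_b}) : R :=
  limn (Ksum_partial R A).

Definition beta (R : realType) (b : nat) (A : {set 'I_b}) (l m : nat) : R :=
  \sum_(b ^ l.-1 <= n < b ^ l | admissible A n) n%:R ^- m.

Definition gamma (R : realType) (b : nat) (A : {set 'I_b}) (j : nat) : R :=
  \sum_(a in A) (val a)%:R ^+ j.

(* The maximum of A when A is nonempty. *)
Definition maxdigit (b : nat) (A : {set 'I_b}) : nat :=
  (\max_(a in A) val a)%N.

Definition tail_partial (R : realType) (b : nat) (A : {set 'I_b})
    (u : nat -> R) (l n : nat) : R :=
  \sum_(1 <= m < n.+1) (-1) ^+ m * u m * beta R A l m.+1.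

(* Main.v *)
Require Import Defs.
From HB Require Import structures.
From mathcomp Require Import all_boot all_order all_algebra.
From mathcomp Require Import all_classical all_reals all_analysis.
From mathcomp Require Import zify ring lra.

Import Order.TTheory GRing.Theory Num.Theory.
Import numFieldNormedType.Exports.

Local Open Scope classical_set_scope.
Local Open Scope ring_scope.

Set Implicit Arguments.
Unset Strict Implicit.

(** Let [mu] be the measure giving mass [b ^- j] to the number [0.d] for every
    string [d] of [j] digits in [A] (all [j >= 0]). Splitting off the first
    digit shows that the moments of [mu] satisfy the recurrence defining [u],
    so [u m] is the [m]-th moment of [mu]. An admissible number with at least
    [l] digits is [b ^ j * (n + 0.d)] with [n] its [l] leading digits, hence the
    part [n >= b ^ l.-1] of [K] is the sum over admissible [l]-digit [n] of the
    integral of [1 / (n + x)] against [mu]. Truncating the expansion of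
    [1 / (n + x)] in powers of [x / n] leaves an error at most the next term,
    and integrating this bound gives the series, whose remainder after [p]
    terms is at most [u p * beta p.+1]. The bounds on [lambda] follow from the
    recurrence by comparison with the moments [1 / m.+1] of Lebesgue measure. *)

(** * Two-sided bounds for solutions of a moment recurrence *)

Section MomentBounds.

(** Since ['C(m, j) / (m - j).+1 = 'C(m.+1, j) / m.+1], this is the binomial expansion of
    [(t + 1) ^+ m.+1] without its two extreme terms. *)
Lemma sum_bin_moment (R : numFieldType) (m : nat) (t : R) :
  \sum_(1 <= j < m.+1) 'C(m, j)%:R * t ^+ j / (m - j).+1%:R
  = ((t + 1) ^+ m.+1 - t ^+ m.+1 - 1) / m.+1%:R.
Proof.
apply: (mulIf (_ : m.+1%:R != 0 :> R)); first by rewrite pnatr_eq0.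
rewrite divfK ?pnatr_eq0// [t + 1]addrC exprDn.
rewrite -(big_mkord xpredT (fun i => 1 ^+ (m.+1 - i) * t ^+ i *+ 'C(m.+1, i))).
rewrite [in RHS]big_nat_recr// [in RHS]big_nat_recl// subnn.
rewrite !expr0 binn bin0 !mulr1n !expr1n !mul1r.
rewrite addrK [X in X - 1]addrC addrK mulr_suml big_add1.
apply: eq_big_nat => j /andP[_ jm].
rewrite expr1n mul1r -[RHS]mulr_natl.
have e : (m.+1%:R * 'C(m, j.+1)%:R = (m - j.+1).+1%:R * 'C(m.+1, j.+1)%:R :> R).
  by rewrite -!natrM (mul_bin_down m.+1 j.+1) subSn.
have -> : 'C(m.+1, j.+1)%:R = (m - j.+1).+1%:R^-1 * (m.+1%:R * 'C(m, j.+1)%:R) :> R.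
  by rewrite e mulKf ?pnatr_eq0.
ring.
Qed.

Lemma sum_lt_subset (R : numDomainType) (b : nat) (S : {set 'I_b}) (G : 'I_b -> R) :
  (#|S| < b)%N -> (forall d, 0 < G d) -> \sum_(d in S) G d < \sum_d G d.
Proof.
move=> Sb G0; rewrite [ltRHS](bigID (mem S))/= ltrDl.
have /existsP[d dS] : [exists d, d \notin S].
  rewrite -negb_forall; apply/negP => /forallP h.
  have : S = [set: 'I_b]%SET by apply/setP => x; rewrite h inE.
  by move=> e; move: Sb; rewrite e cardsT card_ord ltnn.
rewrite (bigD1 d)//= ltr_pwDl// sumr_ge0// => i _; exact: ltW.
Qed.

Lemma leq_maxdigit (b : nat) (A : {set 'I_b}) (a : 'I_b) :
  a \in A -> (val a <= maxdigit A)%N.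
Proof. by move=> aA; exact: (@leq_bigmax_cond _ (mem A) (fun i => val i)). Qed.

Lemma maxdigit_lt (b : nat) (A : {set 'I_b}) : (0 < b)%N -> (maxdigit A < b)%N.
Proof.
move=> b0; rewrite /maxdigit; elim/big_ind: _ => [//|x y xb yb|i _].
  by rewrite gtn_max xb.
exact: ltn_ord.
Qed.

(** Later [w m] is [u m / u 0 * s ^+ m] and [t a] is [s * a]. Keeping [s] free serves both the decay
    of [u] ([s = 1]) and the bounds on [lambda]. *)
Context (R : realType) (b : nat) (A : {set 'I_b}) (t : 'I_b -> R) (w : nat -> R).
Hypothesis Ab : (#|A| < b)%N.
Hypothesis w0 : w 0%N = 1.
Hypothesis w_rec : forall m, (1 <= m)%N ->
  (b%:R ^+ m.+1 - #|A|%:R) * w m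
  = \sum_(a in A) \sum_(1 <= j < m.+1) 'C(m, j)%:R * t a ^+ j * w (m - j)%N.
Hypothesis t_ge0 : forall a, a \in A -> 0 <= t a.

Lemma exp_sub_card_gt0 (m : nat) : 0 < b%:R ^+ m.+1 - #|A|%:R :> R.
Proof.
rewrite subr_gt0 -natrX ltr_nat (leq_trans Ab)// expnS leq_pmulr// expn_gt0.
by rewrite (leq_ltn_trans _ Ab).
Qed.

Lemma moment_ge0 (m : nat) : 0 <= w m.
Proof.
elim/ltn_ind: m => -[|m] IH; first by rewrite w0.
rewrite -(pmulr_rge0 _ (exp_sub_card_gt0 m.+1)) w_rec//.
apply: sumr_ge0 => a aA; rewrite big_nat_cond; apply: sumr_ge0 => j.
rewrite andbT => /andP[j1 jm].
by rewrite !mulr_ge0 ?exprn_ge0 ?t_ge0// IH//; lia.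
Qed.

(* The moments of [w] are compared with those of Lebesgue measure on [0, 1]:
   the translates [t a + [0, 1]] are dominated by distinct unit cells of
   [0, b], at least one of which is left over. *)
Lemma moment_lt (m : nat) :
  (forall a, a \in A -> t a <= (val a + (b.-1 - maxdigit A))%:R) ->
  (1 <= m)%N -> w m < m.+1%:R^-1.
Proof.
move=> t_le; elim/ltn_ind: m => m IH m1.
rewrite -(ltr_pM2l (exp_sub_card_gt0 m)) w_rec//.
pose G (x : R) := \sum_(1 <= j < m.+1) 'C(m, j)%:R * x ^+ j / (m - j).+1%:R.
have b0 : (0 < b)%N by exact: leq_ltn_trans Ab.
(* Shifting the digits so that the largest becomes [b - 1] keeps them distinct and below [b], and
   dominates [t]. *)
pose phi (a : 'I_b) : 'I_b := insubd a (val a + (b.-1 - maxdigit A))%N.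
have f_lt := maxdigit_lt A b0.
have phiE a : a \in A -> val (phi a) = (val a + (b.-1 - maxdigit A))%N.
  move=> aA; rewrite val_insubd ifT//; have := leq_maxdigit aA; lia.
have phi_inj : {in A &, injective phi}.
  by move=> a c aA cA /(congr1 val); rewrite !phiE// => /addIn/val_inj.
apply: (@le_lt_trans _ _ (\sum_(a in A) G (val (phi a))%:R)).
  apply: ler_sum => a aA; apply: ler_sum_nat => j /andP[j1 jm].
  apply: ler_pM; rewrite ?mulr_ge0 ?exprn_ge0 ?t_ge0//.
  - exact: moment_ge0.
  - by rewrite ler_wpM2l// lerXn2r ?nnegrE ?t_ge0// phiE// t_le.
  - have [->|jm'] := eqVneq j m; first by rewrite subnn w0 invr1.
    by apply/ltW/IH; lia.
(* Adding [#|A| / m.+1] to both sides restores the missing terms [j = 0]: each summand becomes the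
   integral of [x ^+ m] over the unit cell starting at [phi a]. *)
rewrite -[ltLHS](addrK (#|A|%:R / m.+1%:R)) [ltRHS]mulrBl ltrD2r.
have -> : #|A|%:R / m.+1%:R = \sum_(a in A) m.+1%:R^-1 :> R.
  by rewrite sumr_const mulr_natl.
rewrite -big_split/=.
pose H (d : 'I_b) : R := G (val d)%:R + m.+1%:R^-1.
rewrite -(big_imset H)//=.
(* The cells tile [[0, b]], so the sum over all digits telescopes. *)
have -> : b%:R ^+ m.+1 / m.+1%:R = \sum_d H d.
  rewrite -(big_mkord xpredT (fun d => G d%:R + m.+1%:R^-1)).
  under eq_bigr do rewrite /G sum_bin_moment -[X in _ + X]mul1r -mulrDl subrK natr1.
  by rewrite -mulr_suml telescope_sumr// expr0n subr0.
apply: sum_lt_subset => [|d]; first by rewrite card_in_imset.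
by rewrite ltr_wpDl ?invr_gt0// sumr_ge0.
Qed.

(** Keeping only the digit [a0] in the recurrence already suffices, because [w 0 = 1] is well above
    the value [1 / b] that the bound would give at [0]. *)
Lemma moment_gt (a0 : 'I_b) (m : nat) :
  (1 < b)%N -> a0 \in A -> t a0 = b%:R - 1 -> (1 <= m)%N ->
  (b%:R * m.+1%:R)^-1 < w m.
Proof.
move=> b1 a0A ta0; elim/ltn_ind: m => m IH m1.
rewrite -(ltr_pM2l (exp_sub_card_gt0 m)) w_rec//.
set c : R := b%:R - 1 in ta0.
have c0 : 0 < c by rewrite subr_gt0 ltr1n.
have b0 : 0 < b%:R :> R by rewrite ltr0n (ltnW b1).
pose S := \sum_(1 <= j < m.+1) 'C(m, j)%:R * c ^+ j * w (m - j)%N.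
apply: (@lt_le_trans _ _ S); last first.
  rewrite (bigD1 a0)//= ta0 lerDl sumr_ge0// => a /andP[aA _].
  by rewrite sumr_ge0// => j _; rewrite !mulr_ge0 ?exprn_ge0 ?t_ge0// moment_ge0.
pose G := \sum_(1 <= j < m.+1) 'C(m, j)%:R * c ^+ j / (m - j).+1%:R.
(* The term [j = m] has [w 0 = 1] in place of [1 / b]; the surplus is
   [c ^+ m * (1 - 1 / b) = c ^+ m.+1 / b]. *)
apply: (@lt_le_trans _ _ (G / b%:R + c ^+ m.+1 / b%:R)); last first.
  rewrite /S /G mulr_suml big_nat_recr//= [leRHS]big_nat_recr//= -addrA.
  apply: lerD; last first.
    rewrite subnn binn w0 invr1 !mul1r !mulr1 -mulrDl exprSr -{1}[c ^+ m]mulr1 -mulrDr.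
    by rewrite {2}/c subrKC mulfK ?gt_eqF.
  apply: ler_sum_nat => j /andP[j1 jm]; rewrite -mulrA ler_wpM2l//.
    by rewrite mulr_ge0// exprn_ge0// ltW.
  by rewrite -invfM mulrC ltW// IH//; lia.
rewrite /G sum_bin_moment {1}/c subrK invfM [_^-1 * _^-1]mulrC mulrA -mulrDl.
rewrite ltr_pM2r ?invr_gt0//.
rewrite -(ltr_pM2r (_ : 0 < m.+1%:R)) ?ltr0n// [ltRHS]mulrDl !divfK ?pnatr_eq0//.
(* With denominators cleared, what remains is [1 < #|A| + m * c ^+ m.+1]. *)
have N1 : 1 <= #|A|%:R :> R by rewrite ler1n card_gt0; apply/set0Pn; exists a0.
have cm : 0 < c ^+ m.+1 by rewrite exprn_gt0.
have mm : 1 <= m%:R :> R by rewrite ler1n.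
rewrite -natr1; set x := c ^+ _ in cm *; set y := b%:R ^+ _.
nra.
Qed.

End MomentBounds.

(** * Sums over digit strings and their moments *)

Section DigitStrings.

Context (R : realType) (b : nat) (A : {set 'I_b}).
Implicit Types (g h : R -> R).

(* [b ^- j] times the sum of [g] over the numbers in [0, 1) with a base-[b]
   expansion of length [j] with all its digits in [A]. *)
Fixpoint level_sum (j : nat) g : R :=
  if j is j'.+1 then
    b%:R^-1 * \sum_(a in A) level_sum j' (fun x => g (((val a)%:R + x) / b%:R))
  else g 0.

Lemma level_sumD j g h :
  level_sum j (fun x => g x + h x) = level_sum j g + level_sum j h.
Proof.
elim: j g h => [//|j IH] g h /=; rewrite -mulrDr -big_split/=.
by congr (_ * _); apply: eq_bigr => a _; rewrite IH.
Qed.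

Lemma level_sumZ j (c : R) g :
  level_sum j (fun x => c * g x) = c * level_sum j g.
Proof.
elim: j g => [//|j IH] g /=; rewrite mulrCA; congr (_ * _).
by rewrite mulr_sumr; apply: eq_bigr => a _; rewrite IH.
Qed.

Lemma level_sum0 j : level_sum j (fun=> 0) = 0.
Proof.
by elim: j => [//|j IH]/=; rewrite big1 ?mulr0// => a _; rewrite IH.
Qed.

Lemma level_sum_sum (I : Type) (r : seq I) (c : I -> R) (g : I -> R -> R) j :
  level_sum j (fun x => \sum_(i <- r) c i * g i x)
  = \sum_(i <- r) c i * level_sum j (g i).
Proof.
elim: r => [|i r IH].
  rewrite big_nil -[RHS](level_sum0 j); congr level_sum.
  by apply/funext => x; rewrite big_nil.
rewrite big_cons -IH -level_sumZ -level_sumD; congr level_sum.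
by apply/funext => x; rewrite big_cons.
Qed.

Hypothesis b1 : (1 < b)%N.
Let f : R := (maxdigit A)%:R.
Let r : R := f / (b%:R - 1).

(** The bound [r] is the number with all digits equal to [f]; by [r * b = f + r], the maps
    [x -> (a + x) / b] with [a] in [A] preserve [[0, r]], so only that interval matters. *)
Lemma level_sum_le j g h : (forall x, 0 <= x <= r -> g x <= h x) ->
  level_sum j g <= level_sum j h.
Proof.
have b0 : 0 < b%:R - 1 :> R by rewrite subr_gt0 ltr1n.
have b0' : 0 < b%:R :> R by rewrite ltr0n (ltnW b1).
have r0 : 0 <= r by rewrite divr_ge0// ltW.
elim: j g h => [|j IH] g h gh /=; first by rewrite gh// lexx r0.
rewrite ler_wpM2l ?invr_ge0//; apply: ler_sum => a aA; apply: IH => x /andP[x0 xr].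
apply: gh; rewrite divr_ge0 ?addr_ge0//= ler_pdivrMr//.
have -> : r * b%:R = f + r.
  by rewrite -{1}(subrK 1 b%:R) mulrDr mulr1 divfK ?gt_eqF.
by rewrite lerD// ler_nat leq_maxdigit.
Qed.

Lemma level_sum_ge0 j g : (forall x, 0 <= x <= r -> 0 <= g x) -> 0 <= level_sum j g.
Proof. by move=> g0; rewrite -(level_sum0 j); exact: level_sum_le. Qed.

Lemma level_sum_norm j g h : (forall x, 0 <= x <= r -> `|g x| <= h x) ->
  `|level_sum j g| <= level_sum j h.
Proof.
move=> gh; rewrite ler_norml -mulN1r -level_sumZ !level_sum_le// => x /gh.
  by move=> /ler_normlW.
by rewrite mulN1r ler_norml => /andP[].
Qed.

(** Moments of [mu] cut off to strings shorter than [k]; being finite sums, they allow exact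
    manipulation before the limit in [k]. *)
Definition level_moment (k m : nat) : R :=
  \sum_(0 <= j < k) level_sum j (fun x => x ^+ m).

Lemma level_sum_exp j m :
  b%:R ^+ m.+1 * level_sum j.+1 (fun x => x ^+ m)
  = \sum_(0 <= i < m.+1) 'C(m, i)%:R * gamma R A i
      * level_sum j (fun x => x ^+ (m - i)).
Proof.
have b0 : b%:R != 0 :> R by rewrite pnatr_eq0 -lt0n (ltnW b1).
rewrite /= exprSr mulrA mulfK// [LHS]mulr_sumr.
under [LHS]eq_bigr => a _.
  rewrite -level_sumZ.
  have -> : (fun x : R => b%:R ^+ m * (((val a)%:R + x) / b%:R) ^+ m)
      = (fun x => \sum_(0 <= i < m.+1) ('C(m, i)%:R * (val a)%:R ^+ i) * x ^+ (m - i)).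
    apply/funext => x; rewrite -exprMn mulrC divfK// addrC exprDn big_mkord.
    by apply: eq_bigr => i _; rewrite -mulr_natl [x ^+ _ * _]mulrC mulrA.
  rewrite level_sum_sum; over.
rewrite [LHS]exchange_big/=; apply: eq_bigr => i _.
by rewrite /gamma mulr_sumr mulr_suml.
Qed.

(** The empty string contributes [0 ^+ m]. In the limit the term [i = 0], with [gamma 0 = #|A|],
    moves to the left and leaves the recurrence of [u]. *)
Lemma level_moment_rec k m :
  b%:R ^+ m.+1 * level_moment k.+1 m
  = b%:R ^+ m.+1 * (m == 0%N)%:R
    + \sum_(0 <= i < m.+1) 'C(m, i)%:R * gamma R A i * level_moment k (m - i).
Proof.
rewrite /level_moment big_nat_recl// mulrDr [level_sum 0 _]/= expr0n; congr (_ + _).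
rewrite [LHS]mulr_sumr; under [LHS]eq_bigr do rewrite level_sum_exp.
by rewrite [LHS]exchange_big/=; apply: eq_bigr => i _; rewrite [RHS]mulr_sumr.
Qed.

Lemma gamma0 : gamma R A 0 = #|A|%:R.
Proof.
rewrite /gamma; under eq_bigr do rewrite expr0.
by rewrite sumr_const.
Qed.

Hypothesis Ab : (#|A| < b)%N.

Lemma maxdigit_ratio_le1 : r <= 1.
Proof.
rewrite ler_pdivrMr ?subr_gt0 ?ltr1n// mul1r lerBrDr natr1 ler_nat.
exact: maxdigit_lt (ltnW b1).
Qed.

(** As [r <= 1], it suffices to bound the total mass, which obeys [M' = 1 + (#|A| / b) * M] with
    fixed point [b / (b - #|A|)]. *)
Lemma level_moment_le k m : level_moment k m <= b%:R / (b%:R - #|A|%:R).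
Proof.
have bA : 0 < b%:R - #|A|%:R :> R by rewrite subr_gt0 ltr_nat.
have b0 : 0 < b%:R :> R by rewrite ltr0n (ltnW b1).
apply: (@le_trans _ _ (level_moment k 0)).
  apply: ler_sum => j _; apply: level_sum_le => x /andP[x0 xr].
  by rewrite expr0 exprn_ile1// (le_trans xr) ?maxdigit_ratio_le1.
elim: k => [|k IH]; first by rewrite /level_moment big_geq// divr_ge0 ?ltW.
rewrite -(ler_pM2l b0) -[X in X * level_moment _ _]expr1 level_moment_rec.
rewrite big_nat1 bin0 mul1r gamma0 expr1 mulr1 subn0.
apply: (le_trans (lerD (lexx _) (ler_wpM2l (ler0n _ _) IH))).
rewrite le_eqVlt; apply/orP; left; apply/eqP.
by field; rewrite gt_eqF.
Qed.

Lemma level_moment_ge0 k m : 0 <= level_moment k m.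
Proof.
apply: sumr_ge0 => j _; apply: level_sum_ge0 => x /andP[x0 _].
exact: exprn_ge0.
Qed.

Lemma level_moment_nd m : nondecreasing_seq (level_moment ^~ m).
Proof.
apply/nondecreasing_seqP => k; rewrite /level_moment big_nat_recr//= lerDl.
by apply: level_sum_ge0 => x /andP[x0 _]; exact: exprn_ge0.
Qed.

Lemma cvg_sumr (I : Type) (s : seq I) (P : pred I) (F : I -> nat -> R) (l : I -> R) :
  (forall i, F i n @[n --> \oo] --> l i) ->
  \sum_(i <- s | P i) F i n @[n --> \oo] --> \sum_(i <- s | P i) l i.
Proof. by move=> Fl; apply: cvg_big => //; exact: add_continuous. Qed.

Context (u : nat -> R).
Hypothesis hu0 : u 0%N = b%:R / (b%:R - #|A|%:R).
Hypothesis hu : forall m : nat, (1 <= m)%N ->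
  (b%:R ^+ m.+1 - #|A|%:R) * u m
  = \sum_(1 <= j < m.+1) 'C(m, j)%:R * gamma R A j * u (m - j)%N.

(** Monotone boundedness gives a limit; passing to the limit in [level_moment_rec] identifies it by
    induction, as [b ^+ m.+1 - #|A|] is nonzero. *)
Lemma cvg_level_moment m : level_moment k m @[k --> \oo] --> u m.
Proof.
elim/ltn_ind: m => m IH.
have cM : cvgn (level_moment ^~ m).
  apply: nondecreasing_is_cvgn; first exact: level_moment_nd.
  by exists (b%:R / (b%:R - #|A|%:R)) => _ [k _ <-]; exact: level_moment_le.
set L := limn (level_moment ^~ m).
have LE : b%:R ^+ m.+1 * L = b%:R ^+ m.+1 * (m == 0%N)%:R
    + (#|A|%:R * L
       + \sum_(1 <= i < m.+1) 'C(m, i)%:R * gamma R A i * u (m - i)%N).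
  have /cvg_lim <- // :
      b%:R ^+ m.+1 * level_moment k.+1 m @[k --> \oo] --> b%:R ^+ m.+1 * L.
    by apply: cvgMl_tmp; rewrite (cvg_shiftS (level_moment ^~ m)).
  apply: cvg_lim => //.
  under eq_cvg do rewrite level_moment_rec big_ltn// bin0 mul1r gamma0 subn0.
  apply: cvgD; first exact: cvg_cst.
  apply: cvgD; first exact: cvgMl_tmp.
  rewrite big_add1 big_mkord; under eq_cvg do rewrite big_add1 big_mkord.
  apply: cvg_sumr => i; apply: cvgMl_tmp; apply: IH.
  by have := ltn_ord i; lia.
suff <- : L = u m by [].
apply: (mulfI (lt0r_neq0 (exp_sub_card_gt0 R Ab m))).
case: m {IH cM} @L LE => [|m] L LE.
  rewrite mulrBl LE hu0 big_geq// mulr1 addr0 addrK mulrCA mulfV ?mulr1 ?expr1//.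
  by rewrite subr_eq0 eqr_nat gtn_eqF.
by rewrite hu// mulrBl LE/= mulr0 add0r addrAC subrr add0r.
Qed.

End DigitStrings.

(** * Admissible integers grouped by number of digits *)

Section DigitBlocks.

Context (b : nat) (A : {set 'I_b}).
Hypothesis b1 : (1 < b)%N.
Let b0 : (0 < b)%N := ltnW b1.

Lemma digits_rcons (n a : nat) :
  (0 < n)%N -> (a < b)%N -> digits b (n * b + a) = a :: digits b n.
Proof.
move=> n0 ab; have /andP[le lt] := trunc_log_bounds b1 n0.
rewrite /digits (@trunc_log_eq _ (trunc_log b n).+1)//; last first.
  rewrite expnSr (leq_trans (leq_mul le (leqnn b)) (leq_addr _ _))/=.
  rewrite [X in (_ < X)%N]expnSr; apply: (@leq_trans (n.+1 * b)); first by lia.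
  by rewrite leq_mul2r lt orbT.
rewrite -[iota 0 _]/(0%N :: iota (1 + 0) (trunc_log b n).+1) map_cons.
rewrite expn0 divn1 modnMDl modn_small//; congr (_ :: _).
rewrite iotaDl -map_comp; apply: eq_map => i /=.
by rewrite expnS divnMA divnMDl// (divn_small ab) addn0.
Qed.

Lemma mem_digit_set (a : 'I_b) : (val a \in [seq val x | x in A]) = (a \in A).
Proof. by rewrite mem_map ?mem_enum//; exact: val_inj. Qed.

Lemma admissible_rcons (n : nat) (a : 'I_b) : (0 < n)%N ->
  admissible A (n * b + val a) = (a \in A) && admissible A n.
Proof. by move=> n0; rewrite /admissible digits_rcons//= mem_digit_set. Qed.

Lemma admissible_digit (a : 'I_b) : admissible A (val a) = (a \in A).
Proof.
have -> : admissible A (val a) = (val a \in [seq val x | x in A]).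
  rewrite /admissible /digits (_ : trunc_log b (val a) = 0%N).
    by rewrite /= expn0 divn1 modn_small// andbT.
  apply/eqP; rewrite trunc_log_eq0; apply/orP; right.
  by have := ltn_ord a; rewrite /=; lia.
exact: mem_digit_set.
Qed.

Lemma sum_block_rcons (R : nmodType) (l : nat) (h : nat -> R) :
  \sum_(b ^ l.+1 <= n < b ^ l.+2 | admissible A n) h n
  = \sum_(b ^ l <= n < b ^ l.+1 | admissible A n) \sum_(a in A) h (n * b + val a)%N.
Proof.
(* Both ranges are extended down to [0], so that the longer one splits into runs of length [b], one
   for each prefix [n]. *)
rewrite big_mkcond/= (@big_nat_widenl _ _ _ _ 0)//= big_mkcond/=.
rewrite [(b ^ l.+2)%N]expnSr big_nat_mul.
rewrite [RHS](@big_nat_widenl _ _ _ _ 0)//= [RHS]big_mkcond/=.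
apply: eq_big_nat => n /andP[_ nl].
rewrite -{1}[(n * b)%N]add0n big_addn mulSn addnK big_mkord.
have [ln|nl'] := leqP (b ^ l) n; last first.
  rewrite andbF big1// => a _; rewrite ifF//; apply/negbTE; rewrite -ltnNge expnSr.
  apply: (@leq_trans (n.+1 * b)); first by have := ltn_ord a; lia.
  by rewrite leq_mul2r nl' orbT.
have n0 : (0 < n)%N by apply: leq_trans ln; rewrite expn_gt0 b0.
rewrite andbT; under [LHS]eq_bigr => a _.
  rewrite expnSr (leq_trans (leq_mul ln (leqnn b)) (leq_addl _ _)) addnC.
  rewrite admissible_rcons//; over.
case: ifP => nA; last by rewrite big1// => a _; rewrite andbF.
by rewrite [RHS]big_mkcond/=; apply: eq_bigr => a _; rewrite andbT.
Qed.

Lemma sum_block_gt0 (R : numDomainType) (l : nat) (h : nat -> R) (a : 'I_b) :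
  a \in A -> (0 < val a)%N -> (forall n, (0 < n)%N -> 0 < h n) ->
  0 < \sum_(b ^ l <= n < b ^ l.+1 | admissible A n) h n.
Proof.
move=> aA a0; elim: l h => [|l IH] h h0.
  rewrite expn0 expn1 big_mkcond/= (@big_nat_widenl _ _ _ _ 0)//= big_mkord.
  rewrite (bigD1 a)//= ?a0// admissible_digit aA ltr_pwDl ?h0//.
  apply: sumr_ge0 => i /andP[i0 _]; case: ifP => // _; exact/ltW/h0.
rewrite sum_block_rcons; apply: IH => n n0.
rewrite (bigD1 a)//= ltr_pwDl ?h0//; first by lia.
by apply: sumr_ge0 => i _; apply/ltW/h0; have := b0; nia.
Qed.

Lemma sum_block_level (R : realType) (l j : nat) :
  \sum_(b ^ (l + j) <= n < b ^ (l + j).+1 | admissible A n) n%:R^-1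
  = \sum_(b ^ l <= n < b ^ l.+1 | admissible A n)
      level_sum A j (fun x => (n%:R + x)^-1) :> R.
Proof.
elim: j l => [|j IH] l.
  by rewrite addn0; apply: eq_bigr => n _; rewrite /= addr0.
(* The last digit [a] of the longer prefix becomes the first fractional digit:
   [n * b + a + x = b * (n + (a + x) / b)]. *)
rewrite -addSnnS IH sum_block_rcons; apply: eq_bigr => n _ /=.
rewrite mulr_sumr; apply: eq_bigr => a _; rewrite -level_sumZ; congr level_sum.
apply/funext => x; rewrite -invfM; congr (_^-1).
by rewrite natrD natrM; field; rewrite pnatr_eq0 -lt0n b0.
Qed.

Lemma sum_blocks_level (R : realType) (l k : nat) :
  \sum_(b ^ l <= n < b ^ (l + k) | admissible A n) n%:R^-1
  = \sum_(b ^ l <= n < b ^ l.+1 | admissible A n)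
      \sum_(0 <= j < k) level_sum A j (fun x => (n%:R + x)^-1) :> R.
Proof.
elim: k => [|k IH].
  by rewrite addn0 big_geq// big1// => n _; rewrite big_geq.
rewrite addnS (@big_cat_nat _ _ _ (b ^ (l + k)))/= ?leq_pexp2l ?leq_addr//.
rewrite IH sum_block_level -big_split/=; apply: eq_bigr => n _.
by rewrite big_nat_recr.
Qed.

Lemma inv_geometric_remainder (R : realFieldType) (n x : R) (p : nat) :
  1 <= n -> 0 <= x ->
  `|(n + x)^-1 - \sum_(0 <= m < p) ((-1) ^+ m * n ^- m.+1) * x ^+ m|
  <= n ^- p.+1 * x ^+ p.
Proof.
move=> n1 x0; have n0 : 0 < n by exact: lt_le_trans n1.
have nx0 : 0 < n + x by exact: ltr_wpDr.
(* The geometric remainder is exact; replacing [n + x] by [n] in its denominator gives the bound. *)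
have -> : (n + x)^-1 - \sum_(0 <= m < p) ((-1) ^+ m * n ^- m.+1) * x ^+ m
    = (-1) ^+ p * (n ^- p * x ^+ p) / (n + x).
  elim: p => [|p IH]; first by rewrite big_geq// subr0 !expr0 invr1 !mul1r.
  rewrite big_nat_recr//= opprD addrA IH !exprS !invfM.
  have := expf_neq0 p (lt0r_neq0 n0); move: (n ^+ p) => y y0.
  by field; rewrite y0 !gt_eqF.
have ? : 0 <= n ^- p * x ^+ p by rewrite mulr_ge0 ?invr_ge0 ?exprn_ge0// ltW.
rewrite normrM normrMsign ger0_norm// gtr0_norm ?invr_gt0//.
rewrite exprSr invfM [leRHS]mulrAC ler_wpM2l//.
by rewrite lef_pV2 ?posrE// lerDl.
Qed.

End DigitBlocks.

(** * The series for [K] and its convergence *)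

Section KempnerSeries.

Context (R : realType) (b : nat) (A : {set 'I_b}).
Hypothesis b1 : (1 < b)%N.
Hypothesis Ab : (#|A| < b)%N.

(** For fixed [k] all sums are finite and may be exchanged freely; the pointwise remainder bound is
    then summed over strings and prefixes. *)
Lemma sum_blocks_approx (l k p : nat) :
  `|\sum_(b ^ l <= n < b ^ (l + k) | admissible A n) n%:R^-1
    - \sum_(0 <= m < p) (-1) ^+ m * level_moment R A k m * beta R A l.+1 m.+1|
  <= level_moment R A k p * beta R A l.+1 p.+1.
Proof.
rewrite sum_blocks_level//.
have -> : \sum_(0 <= m < p) (-1) ^+ m * level_moment R A k m * beta R A l.+1 m.+1
    = \sum_(b ^ l <= n < b ^ l.+1 | admissible A n) \sum_(0 <= j < k)
        level_sum A j (fun x => \sum_(0 <= m < p) ((-1) ^+ m * n%:R ^- m.+1) * x ^+ m).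
  under [RHS]eq_bigr => n _ do under eq_bigr => j _ do rewrite level_sum_sum.
  under [RHS]eq_bigr => n _ do rewrite exchange_big/=.
  rewrite [RHS]exchange_big/=; apply: eq_bigr => m _.
  rewrite /beta/= mulr_sumr; apply: eq_bigr => n _.
  by rewrite /level_moment -mulr_sumr mulrAC.
rewrite -sumrB; apply: (le_trans (ler_norm_sum _ _ _)).
rewrite /beta/= mulr_sumr big_nat_cond [leRHS]big_nat_cond.
apply: ler_sum => n /andP[/andP[ln _] _].
have n1 : 1 <= n%:R :> R by rewrite ler1n (leq_trans _ ln)// expn_gt0 (ltnW b1).
rewrite -sumrB; apply: (le_trans (ler_norm_sum _ _ _)).
rewrite /level_moment mulr_suml; apply: ler_sum => j _.
rewrite -[X in _ - X]mul1r -mulNr -level_sumZ -level_sumD mulrC -level_sumZ.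
apply: level_sum_norm => // x /andP[x0 _].
by rewrite mulN1r inv_geometric_remainder.
Qed.

Context (u : nat -> R).
Hypothesis hu0 : u 0%N = b%:R / (b%:R - #|A|%:R).
Hypothesis hu : forall m : nat, (1 <= m)%N ->
  (b%:R ^+ m.+1 - #|A|%:R) * u m
  = \sum_(1 <= j < m.+1) 'C(m, j)%:R * gamma R A j * u (m - j)%N.

Let bA_gt0 : 0 < b%:R - #|A|%:R :> R.
Proof. by rewrite subr_gt0 ltr_nat. Qed.

Lemma u0_gt0 : 0 < u 0.
Proof. by rewrite hu0 divr_gt0// ltr0n (ltnW b1). Qed.

(* Rescaling the moments by [s] amounts to rescaling the digits. *)
Lemma scaled_moment_rec (s : R) (m : nat) : (1 <= m)%N ->
  (b%:R ^+ m.+1 - #|A|%:R) * (u m / u 0 * s ^+ m)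
  = \sum_(a in A) \sum_(1 <= j < m.+1)
      'C(m, j)%:R * (s * (val a)%:R) ^+ j * (u (m - j)%N / u 0 * s ^+ (m - j)).
Proof.
move=> m1; rewrite [LHS]mulrA [X in X * _]mulrA hu// [RHS]exchange_big/= !mulr_suml.
apply: eq_big_nat => j /andP[j1 jm]; rewrite /gamma mulr_sumr !mulr_suml.
have -> : s ^+ m = s ^+ (m - j) * s ^+ j by rewrite -exprD subnK//; lia.
by apply: eq_bigr => a _; rewrite exprMn; ring.
Qed.

Lemma u_ge0 m : 0 <= u m.
Proof.
apply: (ler_cvg_to (cvg_cst 0) (cvg_level_moment b1 Ab hu0 hu (m := m))).
by apply: nearW => k; exact: level_moment_ge0.
Qed.

(** The domination required by [moment_lt] is [(s - 1) * a <= (s - 1) * f <= b - 1 - f], with [f]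
    the largest digit. *)
Lemma scaled_moment_lt (s : R) (m : nat) :
  1 <= s -> s * (maxdigit A)%:R <= b%:R - 1 ->
  (1 <= m)%N -> u m / u 0 * s ^+ m < m.+1%:R^-1.
Proof.
move=> s1 sf m1.
apply: (@moment_lt R b A (fun a => s * (val a)%:R) (fun m => u m / u 0 * s ^+ m))
  => //.
- by rewrite expr0 mulr1 divff// gt_eqF// u0_gt0.
- by move=> i i1; exact: scaled_moment_rec.
- by move=> a _; rewrite mulr_ge0// (le_trans _ s1).
move=> a aA; have af := leq_maxdigit aA; have fb := maxdigit_lt A (ltnW b1).
rewrite natrD natrB; last by lia.
rewrite -subn1 natrB ?(ltnW b1)//.
have : (val a)%:R <= (maxdigit A)%:R :> R by rewrite ler_nat.
nra.
Qed.

(** The scale [s = 1] gives [u m <= u 0 / m.+1]. This decay yields convergence even where the series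
    is not shown to be geometric. *)
Lemma cvg_u_0 : u m @[m --> \oo] --> 0.
Proof.
have h : u 0 * harmonic m @[m --> \oo] --> u 0 * 0.
  by apply: cvgMl_tmp; exact: cvg_harmonic.
rewrite mulr0 in h; apply: (squeeze_cvgr _ (cvg_cst 0) h).
apply: nearW => -[|m]; first by rewrite /= u_ge0 invr1 mulr1/=.
rewrite u_ge0/= mulrC -ler_pdivrMr ?u0_gt0// ltW//.
rewrite -[ltLHS]mulr1 -[X in _ * X](expr1n _ m.+1).
apply: scaled_moment_lt => //; rewrite mul1r lerBrDr natr1 ler_nat.
exact: maxdigit_lt (ltnW b1).
Qed.

Lemma Ksum_partial_nd : nondecreasing_seq (Ksum_partial R A).
Proof.
apply/nondecreasing_seqP => n; rewrite /Ksum_partial big_mkcond [leRHS]big_mkcond/=.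
by rewrite [leRHS]big_nat_recr//= lerDl; case: ifP.
Qed.

Lemma beta_ge0 l m : 0 <= beta R A l m.
Proof. by apply: sumr_ge0 => n _; rewrite invr_ge0 exprn_ge0. Qed.

Lemma cvg_Ksum_partial : cvgn (Ksum_partial R A).
Proof.
apply: nondecreasing_is_cvgn; first exact: Ksum_partial_nd.
exists (b%:R / (b%:R - #|A|%:R) * beta R A 1 1) => _ [n _ <-].
apply: (@le_trans _ _ (\sum_(b ^ 0 <= k < b ^ (0 + n.+1) | admissible A k) k%:R^-1)).
  rewrite expn0 add0n /Ksum_partial.
  rewrite [leRHS](@big_cat_nat _ _ _ n.+1)//=; last exact/ltnW/ltn_expl.
  by rewrite lerDl sumr_ge0// => i _; rewrite invr_ge0.
(* With [p = 0] the approximating sum is empty, so the remainder bound controls the whole block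
   sum. *)
apply: le_trans (ler_norm _) _; have := sum_blocks_approx 0 n.+1 0.
rewrite [X in _ - X]big_geq// subr0 => /le_trans; apply.
by rewrite ler_wpM2r ?beta_ge0// level_moment_le.
Qed.

Lemma cvg_blocks (l : nat) :
  \sum_(b ^ l <= n < b ^ (l + k) | admissible A n) n%:R^-1 @[k --> \oo]
  --> Ksum R A - \sum_(1 <= n < b ^ l | admissible A n) n%:R^-1.
Proof.
have bl0 i : (0 < b ^ i)%N by rewrite expn_gt0 (ltnW b1).
have e k : \sum_(b ^ l <= n < b ^ (l + k) | admissible A n) n%:R^-1
    = Ksum_partial R A (b ^ (l + k)).-1
      - \sum_(1 <= n < b ^ l | admissible A n) n%:R^-1.
  rewrite /Ksum_partial prednK// [X in X - _](@big_cat_nat _ _ _ (b ^ l))//=.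
    by rewrite [X in X - _]addrC addrK.
  by rewrite leq_pexp2l ?leq_addr// ltnW.
under eq_cvg do rewrite e.
apply: cvgB; last exact: cvg_cst.
apply: (@cvg_comp _ _ _ (fun k => (b ^ (l + k)).-1) (Ksum_partial R A) _ \oo);
  last exact: cvg_Ksum_partial.
move=> P [N _ NP]; exists N => // k /= Nk; apply: NP => /=.
rewrite -ltnS prednK// (leq_ltn_trans Nk)// (leq_ltn_trans (leq_addl l k))//.
exact: ltn_expl.
Qed.

(** Here [p] stays fixed while [k] tends to infinity in [sum_blocks_approx]. *)
Lemma Ksum_approx (l p : nat) :
  `|Ksum R A - \sum_(1 <= n < b ^ l | admissible A n) n%:R^-1
    - \sum_(0 <= m < p) (-1) ^+ m * u m * beta R A l.+1 m.+1|
  <= u p * beta R A l.+1 p.+1.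
Proof.
have cM m := cvg_level_moment b1 Ab hu0 hu (m := m).
apply: (@ler_cvg_to _ \oo _ R
  (fun k => `|\sum_(b ^ l <= n < b ^ (l + k) | admissible A n) n%:R^-1
    - \sum_(0 <= m < p) (-1) ^+ m * level_moment R A k m * beta R A l.+1 m.+1|)
  (fun k => level_moment R A k p * beta R A l.+1 p.+1)).
- apply: cvg_norm; apply: cvgB; first exact: cvg_blocks.
  by apply: cvg_sumr => m; apply: cvgMr_tmp; apply: cvgMl_tmp.
- exact: cvgMr_tmp.
- by apply: nearW => k; exact: sum_blocks_approx.
Qed.

Lemma beta_le l m : beta R A l.+1 m.+1 <= beta R A l.+1 1.
Proof.
rewrite /beta big_nat_cond [leRHS]big_nat_cond.
apply: ler_sum => n /andP[/andP[ln _] _].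
have n1 : (1 <= n)%N by rewrite (leq_trans _ ln)// expn_gt0 (ltnW b1).
rewrite lef_pV2 ?posrE ?exprn_gt0 ?ltr0n//.
by rewrite ler_weXn2l ?ler1n.
Qed.

Lemma cvg_tail (l : nat) :
  tail_partial A u l.+1 n @[n --> \oo]
  --> Ksum R A - \sum_(1 <= n < b ^ l | admissible A n) n%:R^-1
      - u 0 * beta R A l.+1 1.
Proof.
set Z := Ksum R A - _.
have cZ : \sum_(0 <= m < p) (-1) ^+ m * u m * beta R A l.+1 m.+1 @[p --> \oo] --> Z.
  have c0 : u p * beta R A l.+1 1 @[p --> \oo] --> 0.
    by rewrite -(mul0r (beta R A l.+1 1)); apply: cvgMr_tmp; exact: cvg_u_0.
  apply/cvgrPdist_le => e e0; move/cvgrPdist_le/(_ _ e0): c0.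
  apply: filterS => p; rewrite sub0r normrN; apply: le_trans.
  apply: (le_trans (Ksum_approx l p)); apply: le_trans (ler_norm _).
  by rewrite ler_wpM2l ?u_ge0// beta_le.
(* The tail starts at [m = 1] and includes its last index, hence the bound [p.+1] and the subtracted
   term [m = 0]. *)
have -> : tail_partial A u l.+1
    = (fun p => \sum_(0 <= m < p.+1) (-1) ^+ m * u m * beta R A l.+1 m.+1
                - u 0 * beta R A l.+1 1).
  apply/funext => p; rewrite /tail_partial [in RHS]big_ltn// expr0 mul1r.
  by rewrite [X in X - _]addrC addrK.
apply: cvgB; last exact: cvg_cst.
by rewrite (cvg_shiftS (fun p => \sum_(0 <= m < p) _)).
Qed.

Lemma beta_gt0 (a : 'I_b) l m :
  a \in A -> (0 < val a)%N -> 0 < beta R A l.+1 m.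
Proof.
move=> aA a0; apply: (@sum_block_gt0 b A b1 R l (fun n => n%:R ^- m) a) => // n n0.
by rewrite invr_gt0 exprn_gt0 ?ltr0n.
Qed.

Lemma u_le m : u m <= u 0.
Proof.
case: m => [//|m]; rewrite -[leRHS]mul1r -ler_pdivrMr ?u0_gt0//.
apply: (@le_trans _ _ m.+2%:R^-1); last by rewrite invf_le1 ?ltr0n// ler1n.
rewrite -[leLHS]mulr1 -[X in _ * X](expr1n _ m.+1); apply/ltW/scaled_moment_lt => //.
rewrite mul1r lerBrDr natr1 ler_nat; exact: maxdigit_lt (ltnW b1).
Qed.

Lemma beta_le_half l m :
  (forall n, (b ^ l <= n < b ^ l.+1)%N -> admissible A n -> (2 <= n)%N) ->
  beta R A l.+1 m.+1 <= beta R A l.+1 1 * 2^-1 ^+ m.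
Proof.
move=> h; rewrite /beta mulr_suml big_nat_cond [leRHS]big_nat_cond.
apply: ler_sum => n /andP[nl nA].
have n2 : 2 <= n%:R :> R by rewrite ler_nat h.
rewrite expr1 exprS invfM ler_wpM2l ?invr_ge0// -exprVn lerXn2r ?nnegrE ?invr_ge0//.
by rewrite lef_pV2 ?posrE// (lt_le_trans _ n2).
Qed.

(** * Sharper bounds in terms of the largest digit *)

Context (a0 : 'I_b).
Hypothesis a0A : a0 \in A.
Hypothesis a0max : val a0 = maxdigit A.
Hypothesis a0_gt0 : (0 < val a0)%N.

Let f : R := (maxdigit A)%:R.
Let r : R := f / (b%:R - 1).

Let f_gt0 : 0 < f. Proof. by rewrite ltr0n -a0max. Qed.
Let b_gt0 : 0 < b%:R :> R. Proof. by rewrite ltr0n (ltnW b1). Qed.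
Let bm1_gt0 : 0 < b%:R - 1 :> R. Proof. by rewrite subr_gt0 ltr1n. Qed.

Lemma maxdigit_ratio_gt0 : 0 < r. Proof. exact: divr_gt0. Qed.

Let rVf : r^-1 * f = b%:R - 1.
Proof. by rewrite /r invf_div divfK ?gt_eqF. Qed.

(** The scale [r^-1] is the largest that [scaled_moment_lt] allows: it sends the largest digit to
    [b - 1]. The left side will be [lambda] at [m.+1] over [m.+1]. *)
Lemma normalized_moment_lt m : (1 <= m)%N -> u m / u 0 / r ^+ m < m.+1%:R^-1.
Proof.
move=> m1; rewrite -exprVn; apply: scaled_moment_lt => //; last by rewrite rVf.
by rewrite invf_ge1 ?maxdigit_ratio_gt0// maxdigit_ratio_le1.
Qed.

Lemma normalized_moment_gt m :
  (1 <= m)%N -> (b%:R * m.+1%:R)^-1 < u m / u 0 / r ^+ m.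
Proof.
move=> m1; rewrite -exprVn.
apply: (@moment_gt R b A (fun a => r^-1 * (val a)%:R)
  (fun m => u m / u 0 * r^-1 ^+ m) Ab _ _ _ a0) => //.
- by rewrite expr0 mulr1 divff// gt_eqF// u0_gt0.
- by move=> i i1; exact: scaled_moment_rec.
- by move=> a _; rewrite mulr_ge0// invr_ge0 ltW// maxdigit_ratio_gt0.
- by rewrite a0max rVf.
Qed.

Lemma u_le_exp m : u m <= u 0 * r ^+ m.
Proof.
case: m => [|m]; first by rewrite expr0 mulr1.
rewrite -ler_pdivrMr ?exprn_gt0 ?maxdigit_ratio_gt0//.
rewrite -[leRHS]mul1r -ler_pdivrMr ?u0_gt0// mulrAC.
apply: le_trans (ltW (normalized_moment_lt (ltn0Sn m))) _.
by rewrite invf_le1 ?ltr0n// ler1n.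
Qed.

(** The difference [r * u m - u m.+1] integrates [x ^+ m * (r - x)], nonnegative on [[0, r]],
    against [mu]. *)
Lemma u_succ_lt m : u m.+1 < r * u m.
Proof.
have r0 := maxdigit_ratio_gt0.
pose g x : R := r * x ^+ m + (-1) * x ^+ m.+1.
have g0 x : 0 <= x <= r -> 0 <= g x.
  move=> /andP[x0 xr]; rewrite /g exprS mulN1r -mulrBl mulr_ge0 ?exprn_ge0//.
  by rewrite subr_ge0.
(* Strictness comes from the one-digit string [a0], located at [f / b], strictly between [0] and
   [r]. *)
pose d := level_sum A 1 g.
have d0 : 0 < d.
  have gf : 0 < g (f / b%:R).
    rewrite /g exprS mulN1r -mulrBl mulr_gt0 ?exprn_gt0 ?divr_gt0//.
    rewrite subr_gt0 /r ltr_pM2l// ltf_pV2 ?posrE//; lra.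
  rewrite /d /= mulr_gt0 ?invr_gt0// (bigD1 a0)//= addr0 a0max ltr_pwDl//.
  apply: sumr_ge0 => a /andP[aA _]; rewrite addr0; apply: g0.
  rewrite divr_ge0//=; apply: (@le_trans _ _ (f / b%:R)).
    by rewrite ler_wpM2r ?invr_ge0// ler_nat leq_maxdigit.
  by rewrite /r ler_pM2l// lef_pV2 ?posrE//; lra.
rewrite -subr_gt0; apply: (lt_le_trans d0).
have cM m := cvg_level_moment b1 Ab hu0 hu (m := m).
apply: (@ler_cvg_to _ \oo _ R (fun=> d)
  (fun k => r * level_moment R A k m - level_moment R A k m.+1)).
- exact: cvg_cst.
- by apply: cvgB => //; apply: cvgMl_tmp.
(* From [k = 2] on, the cut-off sum contains the level [j = 1], which is [d]. *)
- exists 2%N => // k /= k2.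
  have -> : r * level_moment R A k m - level_moment R A k m.+1
      = \sum_(0 <= j < k) level_sum A j g.
    rewrite /level_moment mulr_sumr -sumrB; apply: eq_bigr => j _.
    by rewrite /g level_sumD !level_sumZ mulN1r.
  rewrite big_ltn ?(ltnW k2)// big_ltn// addrCA lerDl addr_ge0 ?sumr_ge0//.
    exact: level_sum_ge0.
  by move=> j _; exact: level_sum_ge0.
Qed.

End KempnerSeries.

(** * The largest digit and the final assembly *)

Lemma maxdigit_attained (b : nat) (A : {set 'I_b}) :
  A <> finset.set0 -> A <> [set a : 'I_b | val a == 0%N]%SET ->
  exists a0 : 'I_b, [/\ a0 \in A, val a0 = maxdigit A & (0 < val a0)%N].
Proof.
move=> /eqP/set0Pn[a aA] hA0.
have [a0 a0A a0max] : {a0 : 'I_b | a0 \in A & maxdigit A = val a0}.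
  by apply: eq_bigmax_cond; rewrite card_gt0; apply/set0Pn; exists a.
exists a0; split => //; rewrite lt0n; apply/eqP => a00; apply: hA0.
have all0 c : c \in A -> val c = 0%N.
  by move=> cA; have := leq_maxdigit cA; rewrite a0max a00 leqn0 => /eqP.
apply/setP => c; rewrite inE; apply/idP/eqP => [/all0//|c0].
by have -> : c = a by apply: val_inj; rewrite c0 all0.
Qed.
Theorem theorem1 (R : realType) (b : nat) (hb : (1 < b)%N)
    (A : {set 'I_b})
    (hA : A \proper [set: 'I_b]%SET)
    (hA0 : A <> [set a : 'I_b | val a == 0%N]%SET)
    (u : nat -> R)
    (hu0 : u 0%N = b%:R / (b%:R - #|A|%:R))
    (hu : forall m : nat, (1 <= m)%N ->
       (b%:R ^+ m.+1 - #|A|%:R) * u m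
       = \sum_(1 <= j < m.+1) 'C(m, j)%:R * gamma R A j * u (m - j)%N) :
  cvgn (Ksum_partial R A) /\
  (forall l : nat, (1 <= l)%N ->
    [/\ cvgn (tail_partial A u l),
        Ksum R A =
          \sum_(1 <= n < b ^ l.-1 | admissible A n) n%:R^-1
          + b%:R / (b%:R - #|A|%:R)
            * \sum_(b ^ l.-1 <= n < b ^ l | admissible A n) n%:R^-1
          + limn (tail_partial A u l),
        (forall m : nat, (1 <= m)%N -> 0 <= u m * beta R A l m.+1),
        (A <> finset.set0 ->
           forall m : nat, (1 <= m)%N -> 0 < u m * beta R A l m.+1)
      & (~ [/\ l = 1%N, 1%N \in [seq val a | a in A]
             & b.-1 \in [seq val a | a in A]] ->
           exists2 rho : R, 0 < rho < 1 &
             exists C : R, forall m : nat,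
               `|u m * beta R A l m.+1| <= C * rho ^+ m)]) /\
  (A <> finset.set0 ->
    forall lam : nat -> R,
    (forall m : nat,
       u m = lam m.+1 / m.+1%:R * ((maxdigit A)%:R / (b%:R - 1)) ^+ m
             * (b%:R / (b%:R - #|A|%:R))) ->
    [/\ lam 1%N = 1,
        (forall m : nat, (2 <= m.+1)%N -> b%:R^-1 < lam m.+1 < 1),
        (forall m : nat, 0 < lam m.+1 / m.+1%:R),
        (forall m : nat, lam m.+2 / m.+2%:R < lam m.+1 / m.+1%:R)
      & (lam m.+1 / m.+1%:R) @[m --> \oo] --> (0 : R)]).
Proof.
have b0 : (0 < b)%N := ltnW hb.
have Ab : (#|A| < b)%N by rewrite -[X in (_ < X)%N]card_ord -cardsT proper_card.
have bm1 : 0 < b%:R - 1 :> R by rewrite subr_gt0 ltr1n.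
have u0_pos := u0_gt0 hb Ab hu0.
split; first exact: cvg_Ksum_partial.
split.
  case=> // l _; have ct := cvg_tail hb Ab hu0 hu (l := l); split.
  - by apply/cvg_ex; eexists; exact: ct.
  - rewrite (cvg_lim _ ct)// hu0 /beta /=.
    under [X in _ - _ - _ * X]eq_bigr do rewrite expr1.
    by ring.
  - by move=> m _; rewrite mulr_ge0 ?beta_ge0// (u_ge0 hb Ab hu0 hu).
  - move=> An m m1; have [a0 [a0A a0max a0_gt0]] := maxdigit_attained An hA0.
    apply: mulr_gt0; last exact: (beta_gt0 _ hb _ _ a0A).
    have := normalized_moment_gt hb Ab hu0 hu a0A a0max a0_gt0 m1.
    move=> /(lt_trans _) h.
    have {h} : 0 < u m / u 0%N / ((maxdigit A)%:R / (b%:R - 1)) ^+ m.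
      by apply: h; rewrite invr_gt0 mulr_gt0 ?ltr0n.
    rewrite pmulr_lgt0; first by rewrite pmulr_lgt0 ?invr_gt0.
    by rewrite invr_gt0 exprn_gt0// divr_gt0// ltr0n -a0max.
  move=> hl.
  have nrm m : `|u m * beta R A l.+1 m.+1| = u m * beta R A l.+1 m.+1.
    by rewrite ger0_norm// mulr_ge0 ?beta_ge0// (u_ge0 hb Ab hu0 hu).
  have half01 : 0 < (2^-1 : R) < 1 by rewrite invr_gt0 invf_lt1// ltr0n ltr1n.
  (* For empty [A] every [beta] vanishes, since [digits] is never empty. *)
  have [A0|An] := eqVneq A finset.set0.
    exists 2^-1 => //; exists 0 => m; rewrite nrm mul0r.
    have <- : u m * 0 = 0 by rewrite mulr0.
    rewrite ler_wpM2l ?(u_ge0 hb Ab hu0 hu)// /beta big_nat_cond big1// => n.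
    rewrite /admissible /digits A0/= => /andP[_ /andP[+ _]].
    by move=> /mapP[x]; rewrite mem_enum inE.
  have [a0 [a0A a0max a0_gt0]] := maxdigit_attained (elimN eqP An) hA0.
  have [bA|bA] := boolP (b.-1 \in [seq val a | a in A]).
    (* Now [l > 1] or [1] is not a digit in [A] (in the original indexing of [l]), so every [n] in
       the block is at least [2] and [beta] decays at rate [1 / 2]. *)
    exists 2^-1 => //; exists (u 0%N * beta R A l.+1 1) => m; rewrite nrm -mulrA.
    rewrite ler_pM ?(u_ge0 hb Ab hu0 hu) ?beta_ge0// ?(u_le hb Ab hu0 hu)//.
    apply: beta_le_half => // n /andP[ln _] nA.
    case: l hl ln {ct nrm} => [|l] hl ln; last first.
      by rewrite (leq_trans _ ln)// (leq_trans hb)// -[X in (X <= _)%N]expn1 leq_pexp2l.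
    rewrite expn0 in ln; rewrite ltn_neqAle ln andbT; apply/eqP => n1; apply: hl.
    split => //; move: nA; rewrite -n1.
    by have := admissible_digit A hb (Ordinal hb); rewrite -mem_digit_set /= => ->.
  (* Without the digit [b - 1] this ratio is below [1], and [u] itself decays at that rate. *)
  exists ((maxdigit A)%:R / (b%:R - 1)).
    rewrite divr_gt0 ?ltr0n -?a0max//= ltr_pdivrMr// mul1r ltrBrDr natr1 ltr_nat.
    rewrite ltn_neqAle ltn_ord andbT; apply/eqP => e; move/negP: bA; apply.
    have -> : b.-1 = val a0 by rewrite -[in LHS]e.
    by rewrite mem_digit_set.
  exists (u 0%N * beta R A l.+1 1) => m; rewrite nrm mulrAC.
  rewrite ler_pM ?(u_ge0 hb Ab hu0 hu) ?beta_ge0// ?beta_le//.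
  exact: (u_le_exp hb Ab hu0 hu a0max).
move=> An lam hlam.
have [a0 [a0A a0max a0_gt0]] := maxdigit_attained An hA0.
set r : R := (maxdigit A)%:R / (b%:R - 1) in hlam.
have r0 : 0 < r by rewrite divr_gt0// ltr0n -a0max.
(* The ratios are the normalized moments, so their bounds carry over; their monotonicity is
   [u_succ_lt] divided by [u 0 * r ^+ m.+1]. *)
have lamE m : lam m.+1 / m.+1%:R = u m / u 0%N / r ^+ m.
  by rewrite hlam -hu0 mulfK ?gt_eqF// mulfK// gt_eqF// exprn_gt0.
have lam1 : lam 1%N = 1 by have := lamE 0%N; rewrite expr0 !divr1 divff ?gt_eqF.
have lt m : (1 <= m)%N -> lam m.+1 / m.+1%:R < m.+1%:R^-1.
  move=> m1; rewrite lamE.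
  exact: (normalized_moment_lt hb Ab hu0 hu a0max).
have gt m : (1 <= m)%N -> (b%:R * m.+1%:R)^-1 < lam m.+1 / m.+1%:R.
  by move=> m1; rewrite lamE; exact: (normalized_moment_gt hb Ab hu0 hu a0A a0max).
have pos m : 0 < lam m.+1 / m.+1%:R.
  case: m => [|m]; first by rewrite lam1 divr1.
  by apply: lt_trans (gt _ _) => //; rewrite invr_gt0 mulr_gt0 ?ltr0n.
split => //.
- move=> m m1; apply/andP; split.
    by rewrite -(ltr_pM2r (_ : 0 < m.+1%:R^-1)) ?invr_gt0// -invfM gt.
  by rewrite -(ltr_pM2r (_ : 0 < m.+1%:R^-1)) ?invr_gt0// mul1r lt.
- move=> m; rewrite !lamE exprS invfM mulrA ltr_pM2r ?invr_gt0 ?exprn_gt0//.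
  rewrite mulrAC ltr_pM2r ?invr_gt0// ltr_pdivrMr// mulrC.
  exact: (u_succ_lt hb Ab hu0 hu a0A a0max).
- apply: (squeeze_cvgr _ (cvg_cst 0) cvg_harmonic).
  apply: nearW => m; rewrite ltW//=; case: m => [|m]; first by rewrite lam1 mul1r.
  exact/ltW/lt.
Qed.
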